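(* For all non-negative integers $n$, $k$, $r$ (and every integer $s\geq0$ used in the definition of $\widetilde{S}$), the modified Stirling number of the second kind satisfies $$\widetilde{S}(n,k,r)=\sum_{p=r}^{n-k+r}\binom{n}{p}S(n-p,k-r)\,S(p,r).$$
   Context: $S(a,b)$ denotes the classical Stirling number of the second kind, with $S(0,0)=1$ and $S(a,b)=0$ unless $0\leq b\leq a$. Empty sums are $0$, and $\binom{n}{p}=0$ for $p>n$. A partition $\lambda$ is a finite weakly decreasing sequence of positive integers $a_1,\dots,a_L$ (the empty partition is allowed), with length $\ell(\lambda)=L$ and $|\lambda|=\sum_l a_l$; $\lambda\vdash N$ means $|\lambda|=N$. For $i\geq1$, $m_i=m_i(\lambda)$ is the number of indices $l$ with $a_l=i$. For $s\geq0$, $\lambda^{>s}$ is the partition obtained by deleting all parts $a_l\leq s$; $(a)_s=\prod_{\upsilon=0}^{s-1}(a-\upsilon)$; $(\mu)_s$ is the sequence obtained by replacing each part $a_l$ of a partition $\mu$ by $(a_l)_s$. $e_r$ of a finite sequence is the $r$th elementary symmetric function of its entries ($e_0=1$; $e_r=0$ if there are fewer than $r$ entries). The modified partial Bell polynomial is $$\widetilde{\mathcal{B}}_{n,k,r}^{(s)}(y_{1},y_2,\ldots)=\sum_{\substack{\lambda \vdash n+rs \\ \ell(\lambda)=k \\ \ell(\lambda^{>s}) \geq r}}\frac{n!\,e_{r}\big((\lambda^{>s})_{s}\big)}{\prod_{i\geq1}(i!)^{m_{i}}m_{i}!}\prod_{i\geq1}y_{i}^{m_{i}}$$ (which is $0$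 unless $r\leq k\leq n$). It is homogeneous of degree $k$, and of weighted degree $n+rs$ when $y_i$ has weight $i$. The modified Stirling number of the second kind $\widetilde{S}(n,k,r)$ is the number such that substituting $y_i=c^i x$ for all $i$ turns $\widetilde{\mathcal{B}}_{n,k,r}^{(s)}$ into $c^{n+rs}\,\widetilde{S}(n,k,r)\,x^{k}$; equivalently it is the value of $\widetilde{\mathcal{B}}_{n,k,r}^{(s)}$ at $y_i=1$ for all $i$ (this turns out not to depend on $s$). *)

(* Defs.v *)
From mathcomp Require Export all_boot all_order all_algebra.
From mathcomp Require Export mpoly.

Set Implicit Arguments.
Unset Strict Implicit.
Unset Printing Implicit Defensive.

Import GRing.Theory.
Local Open Scope ring_scope.

(* The number of partitions of an a-element set into b nonempty blocks;
   [partition] excludes the empty block. Integer arguments are used so that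
   differences such as n - p and k - r are not truncated. *)
Definition stirling2 (a b : int) : nat :=
  match a, b with
  | Posz a', Posz b' =>
      #|[set P : {set {set 'I_a'}} | partition P [set: 'I_a'] & #|P| == b']|
  | _, _ => 0%N
  end.

(* Integer partitions are weakly decreasing sequences of positive naturals. *)
Definition is_partition_of (N : nat) (lam : seq nat) : bool :=
  [&& sorted geq lam, all (ltn 0) lam & sumn lam == N].

Definition mult (lam : seq nat) (i : nat) : nat := count_mem i lam.

Definition parts_gt (s : nat) (lam : seq nat) : seq nat :=
  [seq a <- lam | (s < a)%N].

Definition falling_parts (s : nat) (mu : seq nat) : seq nat :=
  [seq (a ^_ s)%N | a <- mu].

Definition esym (r : nat) (u : seq nat) : rat :=
  (mesym (size u) rat r).@[fun i => (nth 0%N u i)%:R].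

Definition modified_bell_coef (n r s : nat) (lam : seq nat) : rat :=
  n`!%:R * esym r (falling_parts s (parts_gt s lam))
  / \prod_(1 <= i < (n + r * s).+1)
       (i`!%:R ^+ mult lam i * (mult lam i)`!%:R).

(* Every part of a partition of N is at most N, so only y_1, ..., y_N occur in
   the polynomial, and y_i is the variable of index i - 1. For the same reason
   the partitions of N of length k are enumerated as k-tuples over 'I_N.+1. *)
Definition modified_bell (s n k r : nat) : {mpoly rat[n + r * s]} :=
  \sum_(t : k.-tuple 'I_(n + r * s).+1 |
          is_partition_of (n + r * s) (map val t)
          && (r <= size (parts_gt s (map val t)))%N)
    modified_bell_coef n r s (map val t) *:
      \prod_(i < n + r * s) 'X_i ^+ mult (map val t) i.+1.

Definition modified_stirling2 (s n k r : nat) : rat :=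
  (modified_bell s n k r).@[fun=> 1].

Lemma sum_mult (N : nat) (lam : seq nat) :
  all (fun a => 0 < a <= N)%N lam ->
  (\sum_(i < N) mult lam i.+1 = size lam)%N /\
  (\sum_(i < N) i.+1 * mult lam i.+1 = sumn lam)%N.
Proof.
elim: lam => [|a lam IH] /=.
  by move=> _; split; rewrite big1 // => i _; rewrite muln0.
case/andP=> /andP[a0 aN] /IH[IH1 IH2].
have ltaN : (a.-1 < N)%N by rewrite prednK.
have eqa (i : 'I_N) : (a == i.+1) = (i == Ordinal ltaN).
  by rewrite -(inj_eq val_inj) /= -[in LHS](prednK a0) eqSS eq_sym.
rewrite /mult /=; split.
  rewrite big_split /= IH1 (bigD1 (Ordinal ltaN)) //= prednK // eqxx.
  by rewrite big1 // => i; rewrite eqa => /negbTE->.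
under eq_bigr => i _ do rewrite mulnDr.
rewrite big_split /= IH2 (bigD1 (Ordinal ltaN)) //= prednK // eqxx muln1.
by rewrite big1 ?addn0 // => i; rewrite eqa => /negbTE->; rewrite muln0.
Qed.

(* Evaluation at y_i = 1 gives the number characterized by the substitution
   y_i = c^i x. *)
Lemma modified_stirling2P (s n k r : nat) (c x : rat) :
  (modified_bell s n k r).@[fun i => c ^+ i.+1 * x] =
  c ^+ (n + r * s) * modified_stirling2 s n k r * x ^+ k.
Proof.
rewrite /modified_stirling2 /modified_bell !raddf_sum /= mulr_sumr mulr_suml.
apply: eq_bigr => t /andP[/and3P[_ pos /eqP sumt] _].
rewrite !mevalZ !rmorph_prod /=.
under eq_bigr => i _ do rewrite rmorphXn /= mevalXU exprMn -exprM.
under [in RHS]eq_bigr => i _ do rewrite rmorphXn /= mevalXU expr1n.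
rewrite big1_eq mulr1 big_split /= !prodrXr.
have bnd : all (fun a => 0 < a <= n + r * s)%N (map val t).
  apply/allP=> a at_; apply/andP; split; first exact: (allP pos).
  by case/mapP: at_ => i _ ->; rewrite -ltnS ltn_ord.
have [-> ->] := sum_mult bnd.
by rewrite sumt size_map size_tuple mulrCA mulrA.
Qed.

(* Main.v *)
(* In the sum over compositions (t_1, ..., t_k) of n + rs, which weighs each
   partition k! / prod m_i! times, e_r chooses r parts larger than s, and each
   chosen part a carries (a)_s / a! = 1 / (a - s)!. Hence the modified Stirling
   number is n! / k! * 'C(k, r) times the coefficient of X^(n + rs) in
   E^(k - r) (X^s E)^r, where E = exp(X) - 1. Since E^j / j! is the exponential
   generating function of S(-, j), the Cauchy product of E^r and E^(k - r) is
   the right-hand side. *)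
From mathcomp Require Import ring zify.
Require Import Defs.

Set Implicit Arguments.
Unset Strict Implicit.
Unset Printing Implicit Defensive.

Import GRing.Theory Num.Theory.
Local Open Scope ring_scope.

#[local] Arguments stirling2 : simpl never.

(** * Functions sorted by their fibres *)

(** A function whose fibres are the blocks of [P] factors uniquely as [blk], sending a point to its
    block, followed by an injection of the set of blocks into [U]. *)
Lemma card_preim_partition (T U : finType) (P : {set {set T}}) :
  partition P [set: T] ->
  #|[set f : {ffun T -> U} | preim_partition f [set: T] == P]|
    = (#|U| ^_ #|P|)%N.
Proof.
move=> partP; have tiP := partition_trivIset partP.
have covP x : x \in cover P by rewrite (cover_partition partP).
pose blk x : {A | A \in P} := exist _ (pblock P x) (pblock_mem (covP x)).
have blk_surj A : exists x, blk x == A.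
  have /set0Pn[x Ax] := partition_neq0 partP (valP A).
  by exists x; rewrite -val_eqE /= (def_pblock tiP (valP A) Ax).
pose rep A := xchoose (blk_surj A).
have repK A : blk (rep A) = A by apply/eqP/(xchooseP (blk_surj A)).
pose F (h : {ffun {A | A \in P} -> U}) := [ffun x => h (blk x)].
have F_inj : injective F.
  move=> g h /ffunP eqgh; apply/ffunP=> A; rewrite -(repK A).
  by have := eqgh (rep A); rewrite !ffunE.
rewrite -(_ : #|{: {A | A \in P}}| = #|P|); last exact: card_sig.
rewrite -card_inj_ffuns -(card_imset _ F_inj); apply: eq_card => f.
rewrite inE; apply/eqP/imsetP => [preim_f|[h /[1!inE] /injectiveP h_inj ->]].
  have fE x y : (f x == f y) = (blk x == blk y).
    rewrite -val_eqE /= eq_pblock // -preim_f.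
    by rewrite pblock_equivalence_partition ?inE //; split=> // /eqP->.
  exists [ffun A => f (rep A)]; last first.
    by apply/ffunP=> x; rewrite !ffunE; apply/eqP; rewrite fE repK.
  rewrite inE; apply/injectiveP=> A B; rewrite !ffunE => /eqP.
  by rewrite fE !repK => /eqP.
rewrite -[RHS](preim_partition_pblock partP).
apply: eq_in_imset => x _; apply/setP=> y.
by rewrite !inE !ffunE (inj_eq h_inj) -val_eqE.
Qed.

(* Sorting functions from an n-set to a k-set by their partition into fibres. *)
Lemma expn_sum_stirling2 (n k : nat) :
  (k ^ n)%N = (\sum_(j < k.+1) 'C(k, j) * j`! * stirling2 n j)%N.
Proof.
transitivity (\sum_(P : {set {set 'I_n}} | partition P setT) k ^_ #|P|)%N.
  rewrite -[in LHS](card_ord n) -[in LHS](card_ord k) -card_ffun -sum1_card.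
  rewrite (partition_big (fun f : {ffun 'I_n -> 'I_k} => preim_partition f setT)
    (fun P => partition P setT)) => [|f _]; last exact: preim_partitionP.
  apply: eq_bigr => P partP; rewrite -[k in RHS]card_ord.
  rewrite -card_preim_partition //.
  by rewrite -sum1_card; apply: eq_bigl => f; rewrite inE.
under [RHS]eq_bigr => j _ do
  rewrite bin_ffact /stirling2 -sum1_card big_distrr /= big_mkcond /=.
rewrite exchange_big big_mkcond; apply: eq_bigr => P _ /=.
case: ifP => partP; last by rewrite big1 // => j _; rewrite inE partP.
under eq_bigr => j _ do rewrite inE partP muln1 /=.
rewrite -big_mkcond /=; have [ltPk|ltkP] := ltnP #|P| k.+1.
  by rewrite (big_pred1 (Ordinal ltPk)).
(* With more than [k] blocks there is no injection, and no index [j <= k] equals the number of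
   blocks. *)
rewrite ffact_small // big1 // => j /eqP cardP.
by move: ltkP; rewrite cardP ltnNge -ltnS ltn_ord.
Qed.

(** * Powers of the truncated exponential series *)

(* [exp(X) - 1], truncated after degree [N]. *)
Definition exp1_poly (N : nat) : {poly rat} :=
  \poly_(i < N.+1) (if i is 0%N then 0 else i`!%:R^-1).

Lemma coef_exp1_poly (N i : nat) :
  (exp1_poly N)`_i = if (0 < i <= N)%N then i`!%:R^-1 else 0.
Proof. by rewrite coef_poly ltnS; case: i => [|i] //=. Qed.

Lemma fact_neq0 (n : nat) : n`!%:R != 0 :> rat.
Proof. by rewrite pnatr_eq0 -lt0n fact_gt0. Qed.

Lemma bin_factr (n i : nat) : (i <= n)%N ->
  i`!%:R^-1 * (n - i)`!%:R^-1 = 'C(n, i)%:R / n`!%:R :> rat.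
Proof.
move=> le_in; apply: (canRL (mulfK (fact_neq0 n))).
by rewrite -(bin_fact le_in) !natrM; field; rewrite !fact_neq0.
Qed.

Lemma coef_exp1D_poly (N i : nat) :
  (i <= N)%N -> (1 + exp1_poly N)`_i = i`!%:R^-1.
Proof.
move=> le_iN; rewrite coefD coef1 coef_exp1_poly le_iN andbT.
by case: i {le_iN} => [|i] /=; rewrite ?addr0 ?add0r // fact0 invr1.
Qed.

(** Up to degree [N] this power is [exp(kX)]. In the induction the Cauchy product with one more
    factor is the binomial expansion of [(1 + k)^m]. *)
Lemma coef_exp1D_poly_exp (N k m : nat) : (m <= N)%N ->
  ((1 + exp1_poly N) ^+ k)`_m = k%:R ^+ m / m`!%:R.
Proof.
elim: k m => [|k IHk] m le_mN.
  by rewrite expr0 coef1 expr0n; case: m {le_mN} => [|m]; rewrite ?mul0r.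
rewrite exprSr coefM -nat1r [in RHS]exprDn mulr_suml; apply: eq_bigr => i _.
have le_im : (i <= m)%N by rewrite -ltnS ltn_ord.
rewrite IHk ?(leq_trans le_im) //.
rewrite coef_exp1D_poly ?(leq_trans (leq_subr _ _)) //.
by rewrite expr1n mul1r -mulrA bin_factr // mulrA mulr_natr.
Qed.

(* [k^n] determines the numbers [j! S(n, j)], [j <= k], recursively through
   [expn_sum_stirling2]; the coefficients of [(1 + E)^k] obey the same
   recursion. *)
Lemma stirling2_coef (N m k : nat) : (m <= N)%N ->
  (stirling2 m k)%:R = m`!%:R / k`!%:R * (exp1_poly N ^+ k)`_m.
Proof.
move=> le_mN; rewrite mulrAC; apply: (canRL (mulfK (fact_neq0 k))).
elim/ltn_ind: k => k IHk.
have := coef_exp1D_poly_exp k le_mN; rewrite exprDn coef_sum.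
move/(congr1 (fun x => x * m`!%:R)); rewrite mulfVK ?fact_neq0 //.
rewrite -natrX (expn_sum_stirling2 m) natr_sum mulr_suml !big_ord_recr /=.
set S1 := \sum_(i < k) _; set S2 := \sum_(i < k) _.
have -> : S1 = S2.
  apply: eq_bigr => j _; rewrite expr1n mul1r coefMn !natrM.
  by rewrite -[RHS]mulrA [_`!%:R * _]mulrC IHk //; ring.
rewrite binn mul1n mulr1n expr1n mul1r => /addrI eqS.
by rewrite [RHS]mulrC eqS natrM mulrC.
Qed.

(** * Vanishing of Stirling numbers outside their range *)

Lemma stirling2_small (n k : nat) : (n < k)%N -> stirling2 n k = 0%N.
Proof.
move=> lt_nk; apply: eq_card0 => P; rewrite !inE.
apply/andP=> -[partP /eqP cardP]; move: lt_nk.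
have := card_partition partP; rewrite cardsT card_ord => n_eq.
rewrite -cardP [X in (X < _)%N]n_eq -sum1_card ltnNge.
by rewrite leq_sum // => A PA; rewrite card_gt0 (partition_neq0 partP).
Qed.

Lemma stirling2_neg (a b : int) : (b < 0)%R -> stirling2 a b = 0%N.
Proof. by case: a b => a []. Qed.

(** * From sorted tuples to all tuples *)

Lemma sum_count_mem (T : finType) (s : seq T) :
  (\sum_(x in s) count_mem x s = size s)%N.
Proof.
rewrite big_mkcond -sum1_size (eq_bigr (fun x => \sum_(y <- s) (y == x))%N).
  rewrite exchange_big; apply: eq_bigr => y _ /=.
  by rewrite (bigD1 y) //= eqxx big1 // => x; rewrite eq_sym => /negPf->.
move=> x _; rewrite (_ : (if _ then _ else _) = count_mem x s); last first.
  by case: ifPn => // /count_memPn->.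
by rewrite -sum1_count big_mkcond; apply: eq_bigr => y _ /=; case: (y == x).
Qed.

(** Permutations are sorted by their first entry [x], which leaves a permutation of [rem x s].
    Restoring [x] multiplies the product of factorials by [count_mem x s], and these multiplicities
    add up to [size s]. *)
Lemma size_permutations_multinomial (T : finType) (s : seq T) :
  (size (permutations s) * \prod_a (count_mem a s)`! = (size s)`!)%N.
Proof.
have [m] := ubnP (size s); elim: m s => // m IHm [|x0 s0] le_sm.
  by rewrite big1.
have [n size_s] : exists n, size (x0 :: s0) = n.+1 by exists (size s0).
move: (x0 :: s0) le_sm size_s => {x0 s0} s le_sm size_s.
rewrite (perm_size (permutationsE _)) ?size_s // size_allpairs_dep sumnE.
rewrite big_map big_distrl /= big_uniq ?undup_uniq //=.
under eq_bigl => x do rewrite mem_undup.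
rewrite (_ : (_ `! = (\sum_(x in s) count_mem x s) * n`!)%N); last first.
  by rewrite factS sum_count_mem size_s.
rewrite big_distrl /=; apply: eq_bigr => x sx.
have <- : size (rem x s) = n by rewrite size_rem // size_s.
rewrite -IHm; last by rewrite size_rem // size_s; move: le_sm; rewrite size_s.
rewrite mulnCA; congr (_ * _)%N.
rewrite (bigD1 x) //= [in RHS](bigD1 x) //= mulnA count_mem_rem eqxx.
congr (_ * _)%N; last first.
  by apply: eq_bigr => a /negPf nax;
    rewrite count_mem_rem [x == a]eq_sym nax subn0.
have : (0 < count_mem x s)%N by rewrite -has_count has_pred1.
by case: (count_mem x s) => // c _; rewrite factS subn1.
Qed.

Lemma prod_count_mem (R : comPzRingType) (T : finType) (f : T -> R)
    (s : seq T) :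
  \prod_a f a ^+ count_mem a s = \prod_(a <- s) f a.
Proof.
elim: s => [|x s IHs]; first by rewrite big_nil big1.
rewrite big_cons -IHs; under eq_bigr => a _ do rewrite /= exprD.
rewrite big_split /=; congr (_ * _).
rewrite (bigD1 x) //= eqxx big1 ?mulr1 // => a.
by rewrite eq_sym => /negPf->.
Qed.

(** Tuples are grouped by their sorted rearrangement. The class of a sorted [t] consists of its
    distinct permutations, whose number is the multinomial coefficient
    [k! / prod_a (count_mem a t)!]. *)
Lemma sum_sorted_tuple (T : finType) (leT : rel T) (k : nat)
    (F : seq T -> rat) :
  total leT -> transitive leT -> antisymmetric leT ->
  (forall u v, perm_eq u v -> F u = F v) ->
  \sum_(t : k.-tuple T | sorted leT t) F t / \prod_a (count_mem a t)`!%:R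
    = (\sum_(t : k.-tuple T) F t) / k`!%:R.
Proof.
move=> leT_total leT_tr leT_asym F_perm.
rewrite [in RHS](partition_big (fun t : k.-tuple T => [tuple of sort leT t])
   (fun t : k.-tuple T => sorted leT t)) => [|t _]; last exact: sort_sorted.
rewrite mulr_suml; apply: eq_bigr => t sorted_t.
have sortE (u : k.-tuple T) : ([tuple of sort leT u] == t) = perm_eq u t.
  rewrite -val_eqE /= -{1}(sorted_sort leT_tr sorted_t).
  by apply/eqP/perm_sortP.
rewrite (eq_bigl (fun u : k.-tuple T => perm_eq u t)); last first.
  by move=> u; apply: sortE.
rewrite [in RHS](eq_bigr (fun=> F t)); last by move=> u; apply: F_perm.
have card_perm : #|[pred u : k.-tuple T | perm_eq u t]| = size (permutations t).
  rewrite cardE -(size_map val); apply/perm_size/uniq_perm.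
  - by rewrite map_inj_uniq ?enum_uniq //; apply: val_inj.
  - exact: permutations_uniq.
  move=> u; rewrite mem_permutations; apply/mapP/idP => [[v]|ut].
    by rewrite mem_enum => ? ->.
  have size_u : size u == k by rewrite (perm_size ut) size_tuple.
  by exists (Tuple size_u); rewrite // mem_enum.
have := size_permutations_multinomial t; rewrite size_tuple => fact_k.
rewrite sumr_const card_perm -[_ *+ size _]mulr_natr -fact_k natrM -natr_prod.
have size_neq0 : (size (permutations t))%:R != 0 :> rat.
  rewrite pnatr_eq0 -lt0n; have := fact_gt0 k.
  by rewrite -fact_k muln_gt0 => /andP[].
by rewrite invfM mulrA mulfK.
Qed.

(** * Generating polynomial of a part *)

(** Expanding the product over the sets [J] of positions that contribute their linear term gives the
    monomials of [e_r] for [#|J| = r]. *)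
Lemma esym_coef (r : nat) (u : seq nat) :
  esym r u = (\prod_(a <- u) (1 + a%:R *: 'X))`_r.
Proof.
rewrite (big_nth 0%N) big_mkord; under eq_bigr => i _ do rewrite addrC.
rewrite bigA_distr /esym /mesym raddf_sum coef_sum big_mkcond.
apply: eq_bigr => J _ /=; rewrite -big_mkcond /=.
rewrite [in RHS](eq_bigr
  (fun i : 'I__ => (nth 0%N u i)%:R%:P * 'X)); last first.
  by move=> i _; rewrite mul_polyC.
rewrite big_split /= prodr_const -rmorph_prod mul_polyC coefZ coefXn.
rewrite rmorph_prod /= eq_sym; case: eqP => _; rewrite ?mulr0 ?mulr1 //.
by apply: eq_bigr => i _; rewrite mevalXU.
Qed.

(* The outer variable of [part_poly] marks a part chosen by [e_r], the inner
   one records the size of the part. *)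
Definition part_poly (s a : nat) : {poly {poly rat}} :=
  if (0 < a)%N then
    (a`!%:R^-1 *: 'X^a)%:P
    * map_poly polyC (1 + (if (s < a)%N then (a ^_ s)%:R else 0) *: 'X)
  else 0.

Lemma part_polyE (s a : nat) :
  part_poly s a =
    ((if (0 < a)%N then a`!%:R^-1 else 0) *: 'X^a)%:P
    + ((if (s < a)%N then (a - s)`!%:R^-1 else 0) *: 'X^a)%:P * 'X.
Proof.
rewrite /part_poly; case: posnP => [->|a_gt0].
  by rewrite !scale0r mul0r addr0.
have mapE (c : rat) : map_poly polyC (1 + c *: 'X) = 1 + c%:P%:P * 'X.
  by rewrite raddfD /= rmorph1 map_polyZ map_polyX mul_polyC.
rewrite mapE mulrDr mulr1 mulrA -rmorphM.
congr (_ + _%:P * _); rewrite mulrC mul_polyC scalerA; congr (_ *: _).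
case: ltnP => [lt_sa|_]; last by rewrite mul0r.
rewrite -(ffact_fact (ltnW lt_sa)) natrM invfM mulrA divff ?mul1r //.
by rewrite pnatr_eq0 -lt0n ffact_gt0 ltnW.
Qed.

(** The unmarked parts sum to [E]. The marked ones carry [1 / (a - s)!] and sum to [X^s E], where
    cutting [a] at [N] cuts this [E] at [N - s]. *)
Lemma sum_part_poly (s N : nat) :
  \sum_(a < N.+1) part_poly s a
    = (exp1_poly N)%:P + ('X^s * exp1_poly (N - s))%:P * 'X.
Proof.
have -> : exp1_poly N
    = \sum_(a < N.+1) (if (0 < a)%N then a`!%:R^-1 else 0) *: 'X^a.
  rewrite -(poly_def _ (fun a => if (0 < a)%N then a`!%:R^-1 else 0)).
  by apply/polyP=> i; rewrite coef_exp1_poly coef_poly ltnS;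
    case: (i <= N)%N; case: (0 < i)%N.
have -> : 'X^s * exp1_poly (N - s)
    = \sum_(a < N.+1) (if (s < a)%N then (a - s)`!%:R^-1 else 0) *: 'X^a.
  rewrite -(poly_def _ (fun a => if (s < a)%N then (a - s)`!%:R^-1 else 0)).
  apply/polyP=> i; rewrite coefXnM coef_exp1_poly coef_poly ltnS.
  rewrite subn_gt0 leq_subLR; case: ltnP => [lt_is|le_si].
    by rewrite ltnNge (ltnW lt_is) /=; case: ifP.
  have [le_sN|lt_Ns] := leqP s N; first by
    rewrite subnKC //; case: (i <= N)%N; case: (s < i)%N.
  (* For [N < s] the truncated difference is 0, and both coefficients vanish. *)
  rewrite (_ : (N - s)%N = 0%N); last by apply/eqP; rewrite subn_eq0 ltnW.
  by rewrite addn0 ![(i <= _)%N]leqNgt (leq_trans lt_Ns le_si); case: (s < i)%N.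
rewrite !raddf_sum mulr_suml -big_split /=.
by apply: eq_bigr => a _; rewrite part_polyE.
Qed.

Lemma esym_small (r : nat) (u : seq nat) : (size u < r)%N -> esym r u = 0.
Proof.
move=> lt_ur; rewrite /esym /mesym big_pred0 ?meval0 // => J.
apply: contraTF lt_ur => /eqP <-; rewrite -leqNgt -[X in (_ <= X)%N]card_ord.
exact: max_card.
Qed.

(** The inner degrees add up to [sumn u], and the outer degree counts the chosen parts. A zero part
    kills the product, while a part at most [s] is constant in the outer variable and so is never
    chosen. *)
Lemma coef_prod_part_poly (s N r : nat) (u : seq nat) :
  ((\prod_(a <- u) part_poly s a)`_r)`_N =
    if all (ltn 0) u && (sumn u == N) then
      esym r (falling_parts s (parts_gt s u)) / \prod_(a <- u) a`!%:R
    else 0.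
Proof.
case: (boolP (all _ u)) => [/allP u_gt0|/allPn[a ua]]; last first.
  rewrite -eqn0Ngt => /eqP a0; rewrite (big_rem a) //= {1}/part_poly a0.
  by rewrite mul0r !coef0.
rewrite esym_coef /falling_parts /parts_gt big_map big_filter.
rewrite [in RHS]big_mkcond /=.
pose f a : {poly rat} := if (s < a)%N then 1 + (a ^_ s)%:R *: 'X else 1.
rewrite (eq_big_seq
  (fun a => (a`!%:R^-1 *: 'X^a)%:P * map_poly polyC (f a))); last first.
  by move=> a /u_gt0 /= a_gt0; rewrite /part_poly a_gt0 /f;
    case: ifP; rewrite // scale0r addr0.
rewrite big_split /= -(rmorph_prod polyC) -(rmorph_prod (map_poly polyC)).
rewrite coefCM coef_map /=.
rewrite (eq_bigr (fun a => (a`!%:R^-1)%:P * 'X^a)); last first.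
  by move=> a _; rewrite mul_polyC.
rewrite big_split /= -(rmorph_prod polyC) -expr_sum -sumnE mulrAC -rmorphM.
rewrite coefCM coefXn eq_sym.
rewrite prodfV mulrC; case: eqP => _; last by rewrite mul0r.
by rewrite mul1r mulrC.
Qed.

(** * The modified Stirling number as a coefficient *)

(** The [k]-th power expands into a sum over all [k]-tuples of parts, which [sum_sorted_tuple]
    converts into a sum over weakly decreasing ones, weighted by the inverse factorials of their
    multiplicities. *)
Lemma modified_stirling2_coef (s n k r : nat) :
  modified_stirling2 s n k r =
    n`!%:R / k`!%:R
    * (((\sum_(a < (n + r * s).+1) part_poly s a) ^+ k)`_r)`_(n + r * s).
Proof.
set N := (n + r * s)%N.
pose F (u : seq 'I_N.+1) : rat :=
  n`!%:R * ((\prod_(a <- u) part_poly s a)`_r)`_N.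
have F_perm u v : perm_eq u v -> F u = F v.
  by move=> uv; rewrite /F (perm_big _ uv).
pose leT : rel 'I_N.+1 := relpre val geq.
have := sum_sorted_tuple (leT := leT) k _ _ _ F_perm.
have -> : \sum_(t : k.-tuple 'I_N.+1) F t =
   n`!%:R * (((\sum_(a < N.+1) part_poly s a) ^+ k)`_r)`_N.
  rewrite -mulr_sumr -!coef_sum; congr (_ * ((_ : {poly {poly rat}})`_r)`_N).
  rewrite -[k in RHS]card_ord -prodr_const bigA_distr_bigA /=.
  rewrite (reindex
    (fun f : {ffun 'I_k -> 'I_N.+1} => [tuple f i | i < k])) /=; last first.
    exists (fun t : k.-tuple _ => [ffun i => tnth t i]) => [f|t] _.
      by apply/ffunP=> i; rewrite ffunE tnth_mktuple.
    by apply: eq_from_tnth => i; rewrite tnth_mktuple ffunE.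
  by apply: eq_bigr => f _; rewrite /= big_map big_enum.
rewrite mulrAC => <-; first last.
- by move=> i j /andP[ij ji]; apply/val_inj/anti_leq/andP.
- by move=> j i l ij jl; apply: leq_trans jl ij.
- by move=> i j; apply: leq_total.
rewrite /modified_stirling2 /modified_bell raddf_sum /=.
rewrite big_mkcond [RHS]big_mkcond; apply: eq_bigr => t _.
rewrite /is_partition_of sorted_map -/leT.
case: (sorted leT t) => //=.
rewrite /F -(big_map val xpredT (part_poly s)) coef_prod_part_poly.
case: ifPn => [/andP[/andP[pos ->]] le_r|]; rewrite ?pos /=; last first.
  rewrite negb_and; case: (all _ _ && _) => //= [|_]; last first.
    by rewrite mulr0 mul0r.
  (* Partitions with fewer than [r] parts above [s] contribute 0, since [e_r] vanishes on them. *)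
  by rewrite -ltnNge => lt_r; rewrite esym_small ?size_map // mul0r mulr0 mul0r.
rewrite mevalZ rmorph_prod /= big1 ?mulr1; last first.
  by move=> i _; rewrite rmorphXn /= mevalXU expr1n.
rewrite /modified_bell_coef -/N -!mulrA; congr (_ * (_ * _)); rewrite -invfM.
congr (_^-1); rewrite big_add1 big_mkord big_map.
rewrite -(prod_count_mem (fun a : 'I__ => a`!%:R)) -big_split /= big_ord_recl.
have multE (a : 'I_N.+1) : mult (map val t) a = count_mem a t.
  by rewrite /mult count_map; apply: eq_count => b.
(* The product over ['I_N.+1] also has the index 0; its factor is 1 because all parts are
   positive. *)
rewrite -(multE ord0) (_ : mult _ _ = 0%N) ?expr0 ?fact0 ?mul1r; last first.
  by apply/count_memPn/negP => /(allP pos).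
by apply: eq_bigr => i _; rewrite -multE.
Qed.

(** * The convolution formula *)

Lemma coef_linear_exp (R : comNzRingType) (p q : R) (k r : nat) :
  ((p%:P + q%:P * 'X) ^+ k)`_r = p ^+ (k - r) * q ^+ r *+ 'C(k, r).
Proof.
have coefE i : ((p%:P) ^+ (k - i) * (q%:P * 'X) ^+ i *+ 'C(k, i))`_r
    = if i == r then p ^+ (k - r) * q ^+ r *+ 'C(k, r) else 0.
  rewrite exprMn -!rmorphXn mulrA -rmorphM coefMn coefCM coefXn eq_sym.
  by case: eqP => [->|_]; rewrite ?mulr1 // mulr0 mul0rn.
rewrite exprDn coef_sum; under eq_bigr => i _ do rewrite coefE.
rewrite -big_mkcond /=.
have [lt_rk|lt_kr] := ltnP r k.+1; first by rewrite (big_pred1 (Ordinal lt_rk)).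
by rewrite bin_small // mulr0n big1.
Qed.

Lemma coef_exp1_poly_exp (N m k : nat) : (m <= N)%N ->
  (exp1_poly N ^+ k)`_m = k`!%:R / m`!%:R * (stirling2 m k)%:R.
Proof. by move=> /stirling2_coef->; field; rewrite !fact_neq0. Qed.

(** This is the Cauchy product over the full range [0 <= p <= n], where [r <= k] makes [k - r] a
    true difference of naturals. *)
Lemma modified_stirling2E (s n k r : nat) : (r <= k)%N ->
  modified_stirling2 s n k r =
  (\sum_(p < n.+1)
      'C(n, p) * stirling2 (n - p)%N (k - r)%N * stirling2 p r)%N%:R.
Proof.
move=> le_rk; rewrite modified_stirling2_coef sum_part_poly coef_linear_exp.
(* The factor [(X^s)^r] lowers the degree to be read off from [n + r * s] to [n], which removes the
   dependence on [s]. *)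
rewrite coefMn exprMn -exprM mulrCA coefXnM [(s * r)%N]mulnC.
rewrite ltnNge leq_addl addnK /=.
rewrite [_ * exp1_poly _ ^+ r]mulrC coefM -[_ *+ 'C(k, r)]mulr_natl.
rewrite natr_sum mulrA mulr_sumr.
apply: eq_bigr => p _; have le_pn : (p <= n)%N by rewrite -ltnS.
rewrite (coef_exp1_poly_exp (N := n + r * s) (m := n - p)); last first.
  exact: leq_trans (leq_subr _ _) (leq_addr _ _).
(* The truncation degree [n + r * s - s] is at least [n], except when [r = 0]. *)
have -> : (exp1_poly (n + r * s - s) ^+ r)`_p = (exp1_poly n ^+ r)`_p.
  case: r {le_rk} => [|r]; first by rewrite !expr0.
  rewrite !coef_exp1_poly_exp //.
  by rewrite mulSn addnCA addKn (leq_trans le_pn) ?leq_addr.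
rewrite coef_exp1_poly_exp // -(bin_fact le_rk) -(bin_fact le_pn) !natrM.
by field; rewrite !fact_neq0 !pnatr_eq0 -!lt0n !bin_gt0 le_rk.
Qed.

Theorem corollary15 (s n k r : nat) :
  modified_stirling2 s n k r =
  ((\sum_(r <= p < (n + r).+1 - k)
      'C(n, p) * stirling2 (Posz n - Posz p)%R (Posz k - Posz r)%R
               * stirling2 (Posz p) (Posz r))%N)%:R%R.
Proof.
have [le_rk|lt_kr] := leqP r k; last first.
  (* For [k < r] the left side carries ['C(k, r) = 0], and on the right the integer [k - r] is
     negative. *)
  rewrite modified_stirling2_coef sum_part_poly coef_linear_exp bin_small //.
  rewrite mulr0n coef0 mulr0 big1 // => p _.
  rewrite (_ : stirling2 _ (_ - _) = 0%N) ?muln0 //.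
  by rewrite stirling2_neg // subr_lt0.
rewrite modified_stirling2E //; congr (_%:R).
rewrite -(big_mkord xpredT (fun p =>
  'C(n, p) * stirling2 (n - p)%N (k - r)%N * stirling2 p r)%N).
(* Both sums are compared on [0 <= p <= n]: for [p > n - k + r] one has [n - p < k - r], and for
   [p < r] the factor [S(p, r)] is 0. *)
have le_ub : ((n + r).+1 - k <= n.+1)%N by lia.
rewrite (big_nat_widen _ _ _ _ _ le_ub).
rewrite (big_nat_widenl _ _ _ _ _ (leq0n r)) [RHS]big_mkcond.
apply: eq_big_nat => p /andP[_ lt_pn]; rewrite subzn // subzn //.
case: ifPn => //; rewrite /= negb_and -leqNgt -ltnNge => /orP[le_ubp|lt_pr].
  by rewrite [stirling2 (n - p)%N _]stirling2_small ?muln0 //; lia.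
by rewrite [stirling2 p r]stirling2_small ?muln0.
Qed.
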